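(* Let $X$ and $Y$ be positive semidefinite $n\times n$ complex matrices such that $X^2\le Y^2\le\sqrt{2}\,X^2$. Then there exist positive semidefinite $n\times n$ complex matrices $A$ and $B$ such that $$\frac{A+B}{2}=X\quad\text{and}\quad\left(\frac{A^2+B^2}{2}\right)^{1/2}=Y.$$
   Context: For Hermitian matrices, $X\le Y$ means that $Y-X$ is positive semidefinite (Loewner order). Square roots of positive semidefinite matrices are the positive semidefinite ones. *)

(* Defs.v *)
From mathcomp Require Export all_boot all_order all_algebra.
From mathcomp Require Export classical_sets reals.
From mathcomp Require Export complex.

Set Implicit Arguments.
Unset Strict Implicit.
Unset Printing Implicit Defensive.

Import Order.TTheory GRing.Theory Num.Theory.

Local Open Scope ring_scope.
Local Open Scope sesquilinear_scope.
Local Open Scope classical_set_scope.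

(* In R[i], 0 <= z means that z is real and nonnegative. *)
Definition psdmx (R : realType) (n : nat) (M : 'M[R[i]]_n) : Prop :=
  M \is hermsymmx /\ forall v : 'cV[R[i]]_n, 0 <= (v ^t* *m M *m v) 0 0.

Definition loewner_le (R : realType) (n : nat) (X Y : 'M[R[i]]_n) : Prop :=
  psdmx (Y - X).

(* The positive semidefinite S with S ^+ 2 = M: it exists and is unique when M
   is positive semidefinite; otherwise there is none and the value is 0. *)
Definition psd_sqrtmx (R : realType) (n : nat) (M : 'M[R[i]]_n) : 'M[R[i]]_n :=
  xget 0 [set S : 'M[R[i]]_n | psdmx S /\ S ^+ 2 = M].

(* Main.v *)
Require Import Defs.
From mathcomp Require Import all_boot all_order all_algebra.
From mathcomp Require Import classical_sets reals complex.
Import Order.TTheory GRing.Theory Num.Theory.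
Local Open Scope ring_scope.

(** The proof looks for [A = X + Z] and [B = X - Z]: the cross terms cancel, so
    [(A^2 + B^2) / 2 = X^2 + Z^2], which forces [Z^2 = Y^2 - X^2].  Let [Z] be
    the positive square root of [Y^2 - X^2].  Then [Z^2 <= (sqrt 2 - 1) X^2 <=
    X^2], and [Z <= X] because the square root is operator monotone. *)

Lemma sqrrD_sqrrB (R : pzRingType) (x z : R) :
  (x + z) ^+ 2 + (x - z) ^+ 2 = (x ^+ 2 + z ^+ 2) *+ 2.
Proof.
have ex : x + z + (x - z) = x *+ 2 by rewrite addrACA subrr addr0 mulr2n.
have ez : x + z - (x - z) = z *+ 2 by rewrite opprB addrC addrA subrK mulr2n.
rewrite !expr2 mulrDr mulrBr addrACA -mulrDl -mulrBl ex ez.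
by rewrite !mulrnAl mulrnDl.
Qed.

(** Without commutativity the difference of squares does not factor. Summing the two orders of the
    product cancels the mixed terms [x * z] and [z * x]. *)
Lemma mulrBD_mulrDB (R : pzRingType) (x z : R) :
  (x - z) * (x + z) + (x + z) * (x - z) = (x ^+ 2 - z ^+ 2) *+ 2.
Proof.
have ex : x - z + (x + z) = x *+ 2 by rewrite addrACA addNr addr0 mulr2n.
have ez : x - z - (x + z) = - z *+ 2 by rewrite opprD addrACA subrr add0r mulr2n.
rewrite !expr2 mulrDr mulrBr addrACA -mulrDl -mulrBl ex ez.
by rewrite !mulrnAl mulNr mulrnDl.
Qed.

Section PositiveSemidefinite.
Set Implicit Arguments.
Unset Strict Implicit.
Local Open Scope sesquilinear_scope.
Context {R : realType}.
Local Notation C := R[i].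

Lemma trmxC_mul m n p (A : 'M[C]_(m, n)) (B : 'M[C]_(n, p)) :
  (A *m B)^t* = B^t* *m A^t*.
Proof. by rewrite trmx_mul map_mxM. Qed.

Lemma hermsymmxP n (M : 'M[C]_n) : reflect (M^t* = M) (M \is hermsymmx).
Proof.
by rewrite is_hermitianmxE expr0 scale1r eq_sym; apply: eqP.
Qed.

Lemma hermsymmxD n (M N : 'M[C]_n) :
  M \is hermsymmx -> N \is hermsymmx -> M + N \is hermsymmx.
Proof.
move=> /hermsymmxP hM /hermsymmxP hN.
by apply/hermsymmxP; rewrite linearD /= map_mxD hM hN.
Qed.

Lemma hermsymmxN n (M : 'M[C]_n) : M \is hermsymmx -> - M \is hermsymmx.
Proof.
by move=> /hermsymmxP hM; apply/hermsymmxP; rewrite linearN /= map_mxN hM.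
Qed.

Lemma psdmxD n (M N : 'M[C]_n) : psdmx M -> psdmx N -> psdmx (M + N).
Proof.
move=> [hM pM] [hN pN]; split; first exact: hermsymmxD.
by move=> v; rewrite mulmxDr mulmxDl mxE addr_ge0.
Qed.

Lemma psdmxZ n (a : C) (M : 'M[C]_n) : 0 <= a -> psdmx M -> psdmx (a *: M).
Proof.
move=> a0 [/hermsymmxP hM pM]; split.
  by apply/hermsymmxP; rewrite linearZ /= map_mxZ hM /= geC0_conj.
by move=> v; rewrite -scalemxAr -scalemxAl mxE mulr_ge0.
Qed.

Lemma psdmx_congr m n (U : 'M[C]_(m, n)) (M : 'M[C]_m) :
  psdmx M -> psdmx (U^t* *m M *m U).
Proof.
move=> [/hermsymmxP hM pM]; split.
  by apply/hermsymmxP; rewrite !trmxC_mul trmxCK hM mulmxA.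
by move=> v; have := pM (U *m v); rewrite trmxC_mul !mulmxA.
Qed.

Lemma psdmx_diag n (d : 'rV[C]_n) :
  (forall i, 0 <= d 0 i) -> psdmx (diag_mx d).
Proof.
move=> d0; split.
  apply/hermsymmxP; rewrite tr_diag_mx map_diag_mx; congr diag_mx.
  by apply/rowP => i; rewrite mxE /= geC0_conj.
move=> v; rewrite mul_mx_diag mxE sumr_ge0 // => i _.
by rewrite !mxE mulrAC mulr_ge0 // mulrC mul_conjC_ge0.
Qed.

(** For Hermitian [M], the square is the congruence [M^t* *m 1 *m M] of the identity. *)
Lemma psdmx_sqr n (M : 'M[C]_n) : M \is hermsymmx -> psdmx (M ^+ 2).
Proof.
move=> /hermsymmxP hM; rewrite expr2 -[_ * _]/(_ *m _) -{1}hM -[M^t*]mulmx1.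
apply: psdmx_congr; rewrite -diag_const_mx.
by apply: psdmx_diag => i; rewrite mxE ler01.
Qed.

Lemma hermsymmx_spectral n (M : 'M[C]_n) : M \is hermsymmx ->
  exists (U : 'M_n) (d : 'rV_n), [/\ U \is unitarymx, forall i, d 0 i \is Num.real
    & M = U^t* *m diag_mx d *m U].
Proof.
move=> hM; have /orthomx_spectralP eM := hermitian_normalmx hM.
exists (spectralmx M), (spectral_diag M).
have hU := spectral_unitarymx M.
by split=> // [i|]; [apply/mxOverP/hermitian_spectral_diag_real
                    | rewrite -invmx_unitary].
Qed.

(** Here [v] is column [i] of [U^t*]; since [U *m U^t* = 1], [U] sends it to the basis vector
    [delta_mx i 0], on which [diag_mx d] acts by [d 0 i]. *)
Lemma unitary_eigenvector n (U : 'M[C]_n) (d : 'rV[C]_n) i :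
    U \is unitarymx ->
  let v := U^t* *m delta_mx i (0 : 'I_1) in
  (U^t* *m diag_mx d *m U) *m v = d 0 i *: v /\ v^t* *m v = 1%:M.
Proof.
move=> /unitarymxP hU /=; split.
  rewrite -!mulmxA (mulmxA U) hU mul1mx scalemxAr; congr (_ *m _).
  apply/colP => j; rewrite mul_diag_mx !mxE.
  by case: (j =P i) => [->//|_]; rewrite !mulr0.
rewrite trmxC_mul trmxCK mulmxA -(mulmxA _ U) hU mulmx1 trmx_delta.
apply/matrixP => j k; rewrite !ord1 mxE (bigD1 i) //= big1 => [|l /negPf nl].
  by rewrite !mxE !eqxx rmorph1 mulr1 addr0.
by rewrite !mxE nl mulr0.
Qed.

Lemma qform_eigen n (M : 'M[C]_n) (v : 'cV[C]_n) a :
  M *m v = a *: v -> v^t* *m v = 1%:M -> (v^t* *m M *m v) 0 0 = a.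
Proof. by move=> eM ev; rewrite -mulmxA eM -scalemxAr ev !mxE mulr1. Qed.

(** By the spectral theorem [M] is congruent to the diagonal matrix of its eigenvalues, each
    attained at a unit eigenvector, so only their signs matter. *)
Lemma psdmx_eigen_ge0 n (M : 'M[C]_n) : M \is hermsymmx ->
    (forall a (v : 'cV_n), a \is Num.real -> M *m v = a *: v ->
       v^t* *m v = 1%:M -> 0 <= a) ->
  psdmx M.
Proof.
move=> /hermsymmx_spectral[U [d [hU dR ->]]] h.
apply/psdmx_congr/psdmx_diag => i.
have [eM ev] := unitary_eigenvector d i hU.
exact: h (dR i) eM ev.
Qed.

Lemma psdmx_spectral n (M : 'M[C]_n) : psdmx M ->
  exists (U : 'M_n) (d : 'rV_n), [/\ U \is unitarymx, forall i, 0 <= d 0 i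
    & M = U^t* *m diag_mx d *m U].
Proof.
move=> [/hermsymmx_spectral[U [d [hU _ ->]]] pM].
exists U, d; split=> // i.
have [eM ev] := unitary_eigenvector d i hU.
by rewrite -(qform_eigen eM ev).
Qed.

Lemma psdmx_sqrt_exists n (M : 'M[C]_n) : psdmx M ->
  exists2 S, psdmx S & S ^+ 2 = M.
Proof.
move=> /psdmx_spectral[U [d [/unitarymxP hU d0 ->]]].
(* The root is taken eigenvalue by eigenvalue in the same orthonormal basis. *)
pose s := \row_i sqrtC (d 0 i).
exists (U^t* *m diag_mx s *m U).
  by apply/psdmx_congr/psdmx_diag => i; rewrite mxE sqrtC_ge0.
rewrite expr2 -[LHS]/(_ *m _) -!mulmxA (mulmxA U) hU mul1mx.
rewrite (mulmxA (diag_mx s)) mulmx_diag; congr (_ *m (diag_mx _ *m _)).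
by apply/rowP => i; rewrite !mxE -expr2 sqrtCK.
Qed.

(** Testing [- M] on the eigenvectors of [M] shows that each eigenvalue is both nonnegative and
    nonpositive. *)
Lemma psdmx_anti n (M : 'M[C]_n) : psdmx M -> psdmx (- M) -> M = 0.
Proof.
move=> /psdmx_spectral[U [d [hU d0 eM]]] [_ pN].
suff d_eq0 : d = 0 by rewrite eM d_eq0 raddf0 mulmx0 mul0mx.
apply/rowP => i; apply/le_anti; rewrite mxE d0 andbT.
have [ev v1] := unitary_eigenvector d i hU; rewrite -eM in ev.
have := pN (U^t* *m delta_mx i 0).
by rewrite mulmxN mulNmx mxE oppr_ge0 (qform_eigen ev v1).
Qed.

(** With [D = X - Z] and [S = X + Z], [2 (X^2 - Z^2) = D S + S D].  On a unit
    eigenvector of [D] with eigenvalue [a], the quadratic form of [X^2 - Z^2]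
    is thus [a] times that of [S]. *)
Lemma psdmx_sqrt_monotone n (Z X : 'M[C]_n) :
  psdmx Z -> psdmx X -> psdmx (X ^+ 2 - Z ^+ 2) -> psdmx (X - Z).
Proof.
move=> [hZ pZ] [hX pX] [_ pXZ].
have hD : X - Z \is hermsymmx by apply/hermsymmxD/hermsymmxN.
apply: psdmx_eigen_ge0 => // a v aR ev v1.
(* As [X - Z] is Hermitian and [a] is real, the adjoint of the eigenvector equation makes [v^t*] a
   left eigenvector. *)
have ev' : v^t* *m (X - Z) = a *: v^t*.
  rewrite -[in LHS](elimT (hermsymmxP _) hD) -trmxC_mul ev linearZ /= map_mxZ.
  by rewrite /= (CrealP aR).
have e2 : 2 *: (X ^+ 2 - Z ^+ 2) = (X - Z) *m (X + Z) + (X + Z) *m (X - Z).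
  by rewrite scaler_nat -mulrBD_mulrDB.
have e : v^t* *m (X ^+ 2 - Z ^+ 2) *m v =
    a *: (v^t* *m X *m v + v^t* *m Z *m v).
  apply: (scalerI (a := 2)); first by rewrite pnatr_eq0.
  rewrite [LHS]scalemxAl scalemxAr e2 mulmxDr [LHS]mulmxDl !(mulmxA (v^t*)) ev'.
  rewrite -[X in _ + X]mulmxA ev -scalemxAr -!scalemxAl.
  by rewrite mulmxDr mulmxDl scaler_nat mulr2n.
have := qform_eigen ev v1; rewrite mulmxDr mulmxDl mxE mulmxN mulNmx [X in _ + X]mxE.
(* If [a < 0], the form of [X + Z] at [v] is nonpositive, so the nonnegative forms of [X] and [Z]
   both vanish there. Their difference is [a], a contradiction. *)
move=> ea; case: (real_ge0P aR) => // a_lt0.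
have := pXZ v; rewrite e 2!mxE nmulr_rge0 // => le0.
have eX : (v^t* *m X *m v) 0 0 = 0.
  by apply/le_anti; rewrite pX andbT (le_trans _ le0) // lerDl pZ.
have eZ : (v^t* *m Z *m v) 0 0 = 0.
  by apply/le_anti; rewrite pZ andbT (le_trans _ le0) // lerDr pX.
by rewrite -ea eX eZ subrr ltxx in a_lt0.
Qed.

(** Equal squares are comparable both ways, so monotonicity makes [S - T] and its opposite positive
    semidefinite. *)
Lemma psdmx_sqrt_inj n (S T : 'M[C]_n) :
  psdmx S -> psdmx T -> S ^+ 2 = T ^+ 2 -> S = T.
Proof.
move=> pS pT e.
have p0 : psdmx (0 : 'M[C]_n) by rewrite -(scale0r S); apply: psdmxZ.
apply/eqP; rewrite -subr_eq0; apply/eqP/psdmx_anti; rewrite ?opprB.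
  by apply: (psdmx_sqrt_monotone pT pS); rewrite e subrr; exact: p0.
by apply: (psdmx_sqrt_monotone pS pT); rewrite e subrr; exact: p0.
Qed.

(** By uniqueness of the root, [xget] chooses from a singleton and its default [0] does not
    arise. *)
Lemma psd_sqrtmx_sqr n (S : 'M[C]_n) : psdmx S -> psd_sqrtmx (S ^+ 2) = S.
Proof.
by move=> pS; apply: xget_unique => [|T [pT eT]]; [split | exact: psdmx_sqrt_inj eT].
Qed.

End PositiveSemidefinite.

Theorem corollary7 (R : realType) (n : nat) (X Y : 'M[R[i]]_n)
  (hX : psdmx X) (hY : psdmx Y)
  (hXY : loewner_le (X ^+ 2) (Y ^+ 2))
  (hYX : loewner_le (Y ^+ 2) (sqrtC 2 *: X ^+ 2)) :
  exists A B : 'M[R[i]]_n,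
    [/\ psdmx A, psdmx B,
        2^-1 *: (A + B) = X
      & psd_sqrtmx (2^-1 *: (A ^+ 2 + B ^+ 2)) = Y].
Proof.
have [Z pZ eZ] := psdmx_sqrt_exists hXY.
have pXX : psdmx (X ^+ 2) by case: hX => /psdmx_sqr.
have half (M : 'M[R[i]]_n) : 2^-1 *: (M + M) = M.
  by rewrite -mulr2n -(scaler_nat 2 M) scalerA mulVf ?scale1r ?pnatr_eq0.
exists (X + Z), (X - Z); split.
- exact: psdmxD hX pZ.
- apply: (psdmx_sqrt_monotone pZ hX); rewrite eZ.
  (* After substituting [Z ^+ 2], the upper bound on [Y ^+ 2] reduces the claim to [sqrtC 2 <= 2],
     which is checked on squares as [2 <= 4]. *)
  suff -> : X ^+ 2 - (Y ^+ 2 - X ^+ 2) =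
      (2 - sqrtC 2) *: X ^+ 2 + (sqrtC 2 *: X ^+ 2 - Y ^+ 2).
    apply: (psdmxD _ hYX); apply: (psdmxZ _ pXX).
    rewrite subr_ge0 -(@ler_pXn2r _ 2) ?nnegrE ?sqrtC_ge0 ?ler0n // sqrtCK.
    by rewrite -natrX ler_nat.
  by rewrite scalerBl addrA subrK scaler_nat mulr2n opprB addrA.
- by rewrite addrACA subrr addr0 half.
suff -> : (X + Z) ^+ 2 + (X - Z) ^+ 2 = Y ^+ 2 + Y ^+ 2.
  by rewrite half psd_sqrtmx_sqr.
have -> : Y ^+ 2 = X ^+ 2 + Z ^+ 2 by rewrite eZ addrC subrK.
by rewrite sqrrD_sqrrB mulr2n.
Qed.
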